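(* (i) If $b>1$, then each of $A,A^*,B,B^*,K,K^*,\Phi,\Psi$ is a real matrix. (ii) If $b<-1$, then $\overline A=A'$, $\overline{A^*}=(A^* )'$, $\overline B=B'$, $\overline{B^*}=(B^* )'$, $\overline K=K'$, $\overline{K^*}=(K^* )'$, $\overline\Phi=\Phi'$, $\overline\Psi=\Psi'$.
   Context: Let $\Gamma=(X,R)$ be a finite, undirected, connected, distance-regular graph without loops or multiple edges, with path-length distance $\partial$, diameter $D\ge3$, intersection numbers $c_i,b_i$. Fix $b,\beta\in\mathbb C$ with $b\ne1$ and assume $\Gamma$ has classical parameters $(D,b,\alpha,\beta)$ with $\alpha=b-1$, i.e. $c_i=b^{i-1}\frac{b^i-1}{b-1}$, $b_i=(\beta+1-b^i)\frac{b^D-b^i}{b-1}$ ($0\le i\le D$); then $b$ is an integer with $b\ne0,-1$. Fix $q\in\mathbb C$ with $q^2=b$, and put $q'=-q$. Let $E_0,\dots,E_D$ be the primitive idempotents of the Bose–Mesner algebra ordered so that Krein parameters equal intersection numbers ($q^h_{ij}=p^h_{ij}$); $\Gamma$ is $Q$-polynomial for this ordering. Let $V=\mathbb C X$ with Hermitian form $\langle u,v\rangle=u^t\overline v$. Fix a vertex $x$; $E^*_i$ is the diagonal matrix with $(y,y)$-entry $1$ if $\partial(x,y)=i$, else $0$. For $-1\le i,j\le D$: $V^{\downarrow\downarrow}_{i,j}=(E^*_0V+\dots+E^*_iV)\cap(E_0V+\dots+E_jV)$, $V^{\uparrow\downarrow}_{i,j}=(E^*_DV+\dots+E^*_{D-i}V)\cap(E_0V+\dots+E_jV)$,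 $V^{\downarrow\uparrow}_{i,j}=(E^*_0V+\dots+E^*_iV)\cap(E_DV+\dots+E_{D-j}V)$, $V^{\uparrow\uparrow}_{i,j}=(E^*_DV+\dots+E^*_{D-i}V)\cap(E_DV+\dots+E_{D-j}V)$ (zero if $i=-1$ or $j=-1$). For $0\le i,j\le D$, $\tilde V^{\mu\nu}_{i,j}$ is the orthogonal complement of $V^{\mu\nu}_{i-1,j}+V^{\mu\nu}_{i,j-1}$ in $V^{\mu\nu}_{i,j}$; for each $\mu,\nu$, $V=\bigoplus_{i,j}\tilde V^{\mu\nu}_{i,j}$. Define $A=\sum_{i=0}^Dq^{D-2i}E_i$, $A^*=\sum_{i=0}^Dq^{D-2i}E^*_i$, and $B,B^*,K,K^*,\Phi,\Psi$ as the unique matrices such that for all $0\le i,j\le D$: $B=q^{i-j}I$ on $\tilde V^{\downarrow\uparrow}_{i,j}$; $B^*=q^{j-i}I$ on $\tilde V^{\uparrow\downarrow}_{i,j}$; $K=q^{i-j}I$ on $\tilde V^{\downarrow\downarrow}_{i,j}$; $K^*=q^{i-j}I$ on $\tilde V^{\uparrow\uparrow}_{i,j}$; $\Phi=q^{i+j-D}I$ on $\tilde V^{\downarrow\downarrow}_{i,j}$; $\Psi=q^{i+j-D}I$ on $\tilde V^{\downarrow\uparrow}_{i,j}$. For each such matrix $S$, $S'$ denotes the matrix defined in the same way with $q$ replaced by $q'$. *)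

(* Defs.v *)
From HB Require Import structures.
From mathcomp Require Import all_boot all_order all_algebra.
Set Implicit Arguments.
Unset Strict Implicit.
Unset Printing Implicit Defensive.
Import Order.TTheory GRing.Theory Num.Theory.
Local Open Scope ring_scope.

Section Graph.
Variables (X : finType) (e : rel X).

Definition has_walk (k : nat) (y z : X) : bool :=
  [exists w : k.-tuple X, path e y w && (last y w == z)].

(* The least k < #|X| such that a walk of length k joins y and z; the junk
   value #|X| is only taken when y and z are in distinct components. *)
Definition gdist (y z : X) : nat :=
  find (fun k => has_walk k y z) (iota 0 #|X|).

Definition diameter : nat := \max_(y : X) \max_(z : X) gdist y z.

(* The indices range over all of nat: for h beyond the diameter the condition
   is void, and for i or j beyond it the condition forces p h i j = 0. *)
Definition has_intersection_numbers (p : nat -> nat -> nat -> nat) : Prop :=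
  forall (h i j : nat) (y z : X), gdist y z = h ->
    #|[set t | (gdist y t == i) && (gdist t z == j)]| = p h i j.

End Graph.

(* Distance-regularity is the existence of p with has_intersection_numbers;
   p h i j stands for p^h_{ij}. *)
Definition c_ (p : nat -> nat -> nat -> nat) (i : nat) : nat :=
  if i is i'.+1 then p i 1%N i' else 0%N.
Definition b_ (p : nat -> nat -> nat -> nat) (i : nat) : nat := p i 1%N i.+1.

Section Algebra.
Variables (C : numClosedFieldType) (X : finType) (e : rel X) (D : nat).

(* Rows and columns are indexed by X through enum_val : 'I_#|X| -> X. *)
Local Notation Mat := 'M[C]_#|X|.
Local Notation Vec := 'cV[C]_#|X|.

(* Classical parameters (D, b, alpha, beta) with alpha = b - 1. *)
Definition classical_parameters_alpha_b1 (p : nat -> nat -> nat -> nat)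
    (b beta : C) : Prop :=
  forall i : nat, (i <= D)%N ->
    (c_ p i)%:R = b ^ (i%:Z - 1) * ((b ^+ i - 1) / (b - 1)) /\
    (b_ p i)%:R = (beta + 1 - b ^+ i) * ((b ^+ D - b ^+ i) / (b - 1)).

Definition distance_mx (i : nat) : Mat :=
  \matrix_(y, z) (gdist e (enum_val y) (enum_val z) == i)%:R.

Definition bose_mesner : {vspace Mat} :=
  (\sum_(i < D.+1) <[distance_mx i]>)%VS.

Definition idempotent_in (M : {vspace Mat}) (F : Mat) : Prop :=
  F \in M /\ F *m F = F.

Definition primitive_idempotent (M : {vspace Mat}) (F : Mat) : Prop :=
  [/\ idempotent_in M F, F != 0 &
      forall G H : Mat, idempotent_in M G -> idempotent_in M H ->
        G *m H = 0 -> H *m G = 0 -> F = G + H -> G = 0 \/ H = 0].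

Definition primitive_idempotents (E : 'I_D.+1 -> Mat) : Prop :=
  injective E /\
  forall F : Mat, primitive_idempotent bose_mesner F <-> exists i, F = E i.

(* kr h i j stands for q^h_{ij}; the left-hand side is the entrywise product. *)
Definition krein_parameters (E : 'I_D.+1 -> Mat)
    (kr : 'I_D.+1 -> 'I_D.+1 -> 'I_D.+1 -> C) : Prop :=
  forall i j : 'I_D.+1,
    map2_mx *%R (E i) (E j) = #|X|%:R^-1 *: \sum_(h < D.+1) kr h i j *: E h.

Definition dual_idempotent (x : X) (i : 'I_D.+1) : Mat :=
  \matrix_(y, z) ((y == z) && (gdist e x (enum_val y) == i))%:R.

Definition hform (u v : Vec) : C := (u^T *m map_mx Num.conj v) 0 0.

Definition image_space (S : Mat) : {vspace Vec} := limg (linfun (mulmx S)).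

Inductive arrow := Down | Up.

(* F_0 V + ... + F_i V for Down and F_D V + ... + F_(D-i) V for Up; the
   index i is an integer, so that i = -1 gives the zero space. *)
Definition flag (mu : arrow) (F : 'I_D.+1 -> Mat) (i : int) : {vspace Vec} :=
  match mu with
  | Down => (\sum_(r < D.+1 | (r%:Z <= i)%R) image_space (F r))%VS
  | Up => (\sum_(r < D.+1 | (r%:Z <= i)%R) image_space (F (rev_ord r)))%VS
  end.

Section Split.
Variables (E : 'I_D.+1 -> Mat) (x : X).

Definition Vsplit (mu nu : arrow) (i j : int) : {vspace Vec} :=
  (flag mu (dual_idempotent x) i :&: flag nu E j)%VS.

Definition in_Vtilde (mu nu : arrow) (i j : int) (v : Vec) : Prop :=
  v \in Vsplit mu nu i j /\
  forall u : Vec, u \in (Vsplit mu nu (i - 1) j + Vsplit mu nu i (j - 1))%VS ->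
    hform v u = 0.

Definition acts_on_Vtilde (mu nu : arrow) (f : int -> int -> C) (S : Mat) :
    Prop :=
  forall (i j : 'I_D.+1) (v : Vec),
    in_Vtilde mu nu i j v -> S *m v = f i j *: v.

Definition mxA (q : C) : Mat :=
  \sum_(i < D.+1) q ^ (D%:Z - 2 * i%:Z) *: E i.
Definition mxAs (q : C) : Mat :=
  \sum_(i < D.+1) q ^ (D%:Z - 2 * i%:Z) *: dual_idempotent x i.

(* For a self-dual ordering E, each of the following conditions is met by
   exactly one S: uniqueness holds because the spaces Vtilde span V, existence
   because their sum is direct. *)
Definition is_B (q : C) (S : Mat) : Prop :=
  acts_on_Vtilde Down Up (fun i j => q ^ (i - j)) S.
Definition is_Bs (q : C) (S : Mat) : Prop :=
  acts_on_Vtilde Up Down (fun i j => q ^ (j - i)) S.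
Definition is_K (q : C) (S : Mat) : Prop :=
  acts_on_Vtilde Down Down (fun i j => q ^ (i - j)) S.
Definition is_Ks (q : C) (S : Mat) : Prop :=
  acts_on_Vtilde Up Up (fun i j => q ^ (i - j)) S.
Definition is_Phi (q : C) (S : Mat) : Prop :=
  acts_on_Vtilde Down Down (fun i j => q ^ (i + j - D%:Z)) S.
Definition is_Psi (q : C) (S : Mat) : Prop :=
  acts_on_Vtilde Down Up (fun i j => q ^ (i + j - D%:Z)) S.

End Split.
End Algebra.

Definition real_mx (C : numClosedFieldType) (n : nat) (S : 'M[C]_n) : Prop :=
  forall y z, S y z \is Num.real.
Definition conj_mx (C : numClosedFieldType) (n : nat) (S : 'M[C]_n) : 'M[C]_n :=
  map_mx Num.conj S.

(* Main.v *)
(* Complex conjugation fixes every [E i] (a primitive idempotent of an algebra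
   of symmetric matrices, so [conj_mx (E i)] is its adjoint) and every dual
   idempotent, hence it preserves each split subspace and each orthogonal
   complement [in_Vtilde].  If [S] acts on these by scalars in [q], then
   [conj_mx S] acts on them by the same scalars in [q^*], and as they span the
   whole space this determines [conj_mx S].  Finally [q^*] is [q] when
   [q ^+ 2 > 0] and [- q] when [q ^+ 2 < 0]. *)
Require Import Defs.
From HB Require Import structures.
From mathcomp Require Import all_boot all_order all_algebra.
From mathcomp Require Import reals complex.
Import Order.TTheory GRing.Theory Num.Theory.
Local Open Scope ring_scope.

(** * The Hermitian form and orthogonal projection *)

Section Hermitian.
Variables (C : numClosedFieldType) (X : finType).
Local Notation Vec := 'cV[C]_#|X|.
Local Notation hf := (@hform C X).

Lemma hformE (u v : Vec) : hf u v = \sum_i u i 0 * (v i 0)^*.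
Proof. by rewrite /hform mxE; apply: eq_bigr => i _; rewrite !mxE. Qed.

Lemma hform_sub (u v w : Vec) : hf (u - v) w = hf u w - hf v w.
Proof. by rewrite /hform linearB mulmxBl !mxE. Qed.

Lemma hform_scale a (u w : Vec) : hf (a *: u) w = a * hf u w.
Proof. by rewrite /hform linearZ -scalemxAl !mxE. Qed.

Lemma hform_addr (u v w : Vec) : hf w (u + v) = hf w u + hf w v.
Proof. by rewrite /hform raddfD mulmxDr !mxE. Qed.

Lemma hform_scaler a (u w : Vec) : hf w (a *: u) = a^* * hf w u.
Proof. by rewrite /hform map_mxZ -scalemxAr !mxE. Qed.

Lemma hform0r (u : Vec) : hf u 0 = 0.
Proof. by rewrite -(scale0r (0 : Vec)) hform_scaler rmorph0 mul0r. Qed.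

Lemma hform_eq0 (u : Vec) : hf u u = 0 -> u = 0.
Proof.
rewrite hformE => /psumr_eq0P h; apply/colP => i; rewrite mxE; apply/eqP.
by rewrite -normr_eq0 -sqrf_eq0 normCK h // => k _; rewrite mul_conjC_ge0.
Qed.

Lemma hform_conj (u v : Vec) :
  hf (map_mx Num.conj u) v = (hf u (map_mx Num.conj v))^*.
Proof.
rewrite !hformE rmorph_sum; apply: eq_bigr => i _.
by rewrite rmorphM /= !mxE conjCK.
Qed.

(** Gram-Schmidt, by induction on a spanning list and for all [v] at once, so that the new generator
    can itself be projected. *)
Lemma orthogonal_projection (W : {vspace Vec}) (v : Vec) :
  exists2 w, w \in W & forall u, u \in W -> hf (v - w) u = 0.
Proof.
rewrite -(span_basis (vbasisP W)); elim: {W}(vbasis W : seq _) v => [|y s IHs] v.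
  exists 0; first exact: mem0v.
  move=> u; rewrite span_nil memv0 => /eqP ->.
  exact: hform0r.
have [y1 sy1 y1P] := IHs y; have [v1 sv1 v1P] := IHs v.
move: y1P; set z := y - y1 => y1P; have yE : y = z + y1 by rewrite subrK.
rewrite span_cons; clearbody z.
have subs: (<<s>> <= <[y]> + <<s>>)%VS by exact: addvSr.
(* If [hf z z = 0], then [z = 0] and the junk value of the quotient is harmless. *)
exists (v1 + (hf (v - v1) z / hf z z) *: z).
  apply: memvD; first exact: (subvP subs).
  rewrite -[z](addrK y1) -yE; apply/memvZ/memvB; last exact: (subvP subs).
  exact: (subvP (addvSl _ _)) (memv_line y).
move=> u /memv_addP[_ /vlineP[k ->] [t st ->]].
have ->: k *: y + t = k *: z + (k *: y1 + t).
  by rewrite addrA -scalerDr -yE.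
have st': k *: y1 + t \in <<s>>%VS by rewrite memvD ?memvZ.
rewrite opprD addrA; move: (v - v1) v1P => r rP.
rewrite hform_addr hform_scaler !hform_sub !hform_scale (y1P _ st') (rP _ st').
rewrite mulr0 subr0 addr0.
have [/hform_eq0 ->|zn0] := eqVneq (hf z z) 0.
  by rewrite !hform0r mulr0 subr0 mulr0.
by rewrite divfK // subrr mulr0.
Qed.

End Hermitian.

(** * The Bose-Mesner algebra and its primitive idempotents *)

Section RealIdempotents.
Variables (C : numClosedFieldType) (X : finType) (e : rel X) (D : nat).
Variable p : nat -> nat -> nat -> nat.
Hypothesis e_sym : symmetric e.
Hypothesis e_diam : diameter e = D.
Hypothesis e_dr : has_intersection_numbers e p.
Local Notation Mat := 'M[C]_#|X|.
Local Notation A_ := (@distance_mx C X e).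
Local Notation BM := (@bose_mesner C X e D).

Lemma bose_mesnerP (F : Mat) :
  reflect (exists c : 'I_D.+1 -> C, F = \sum_i c i *: A_ i) (F \in BM).
Proof.
apply: (iffP memv_sumP) => [[G GP ->]|[c ->]].
  have cP i : exists c, G i == c *: A_ i by case/vlineP: (GP i isT) => c ->; exists c.
  exists (fun i => xchoose (cP i)); apply: eq_bigr => i _.
  exact/eqP/(xchooseP (cP i)).
by exists (fun i => c i *: A_ i) => // i _; rewrite memvZ ?memv_line.
Qed.

Lemma has_walk_sym k y z : has_walk e k y z = has_walk e k z y.
Proof.
suff imp u v : has_walk e k u v -> has_walk e k v u by apply/idP/idP; apply: imp.
case/existsP=> w /andP[wP /eqP wl].
(* The tuple of a walk omits its starting vertex, so the reversed walk drops [v] and ends in [u]. *)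
have sz : size (rev (belast u w)) == k by rewrite size_rev size_belast size_tuple.
apply/existsP; exists (Tuple sz); rewrite /= -wl rev_path.
rewrite (eq_path (e' := e)) ?wP /= => [|a c]; last exact: e_sym.
case/lastP: (tval w) => //= s a; rewrite belast_rcons last_rcons rev_cons.
by rewrite last_rcons.
Qed.

Lemma gdist_sym y z : gdist e y z = gdist e z y.
Proof. by apply: eq_find => k; apply: has_walk_sym. Qed.

Lemma gdist_eq0 y z : (gdist e y z == 0%N) = (y == z).
Proof.
(* The search range [iota 0 #|X|] must contain 0. *)
have : (0 < #|X|)%N by apply/card_gt0P; exists y.
rewrite /gdist; case: #|X| => //= n _.
have ->: has_walk e 0 y z = (y == z).
  apply/existsP/idP => [[w]|yz]; first by rewrite (tuple0 w).
  by exists [tuple].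
by case: (y == z).
Qed.

Lemma gdist_le y z : (gdist e y z <= D)%N.
Proof.
rewrite -e_diam /diameter.
apply: leq_trans (leq_bigmax (F := fun y => \max_z gdist e y z) y).
exact: (leq_bigmax (F := fun z => gdist e y z) z).
Qed.

Lemma distance_mx0 : A_ 0 = 1%:M.
Proof.
by apply/matrixP=> i j; rewrite !mxE gdist_eq0 (inj_eq enum_val_inj).
Qed.

(** An entry on the left counts the vertices at distances [i] and [j] from its two indices; on the
    right only the term with [h] equal to their distance survives. *)
Lemma distance_mx_mul i j :
  A_ i *m A_ j = \sum_(h < D.+1) (p h i j)%:R *: A_ h.
Proof.
apply/matrixP => y z; rewrite mxE summxE.
set d := gdist e (enum_val y) (enum_val z).
have dD : (d < D.+1)%N by rewrite ltnS gdist_le.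
rewrite [RHS](bigD1 (Ordinal dD)) //= [X in _ = _ + X]big1 => [|h hd]; last first.
  have dh : (d == h) = false by apply: (contra_neqF _ hd) => /eqP ?; apply: val_inj.
  by rewrite !mxE -/d dh mulr0.
rewrite !mxE -/d eqxx mulr1 addr0 -(e_dr d i j _ _ (erefl d)) -[X in _ = X%:R]sum1_card natr_sum.
rewrite [RHS]big_mkcond [RHS](reindex _ (onW_bij _ (@enum_val_bij X))) /=.
apply: eq_bigr => k _; rewrite !mxE inE -natrM mulnb.
by case: andP.
Qed.

Lemma bose_mesner_tr F : F \in BM -> F^T = F.
Proof.
case/bose_mesnerP => c ->; rewrite linear_sum; apply: eq_bigr => i _.
by rewrite linearZ /=; congr (_ *: _); apply/matrixP => y z; rewrite !mxE gdist_sym.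
Qed.

Lemma bose_mesner_conj F : F \in BM -> conj_mx F \in BM.
Proof.
case/bose_mesnerP => c ->; apply/bose_mesnerP; exists (fun i => (c i)^*).
rewrite /conj_mx raddf_sum; apply: eq_bigr => i _ /=; rewrite map_mxZ /=.
by congr (_ *: _); apply/matrixP => y z; rewrite !mxE conjC_nat.
Qed.

Lemma bose_mesner_mul F G : F \in BM -> G \in BM -> F *m G \in BM.
Proof.
case/bose_mesnerP => c -> /bose_mesnerP[d ->]; rewrite mulmx_suml.
apply: memv_suml => i _; rewrite mulmx_sumr; apply: memv_suml => j _.
rewrite -scalemxAl -scalemxAr !memvZ //; apply/bose_mesnerP.
by exists (fun h => (p h i j)%:R); apply: distance_mx_mul.
Qed.

(** All members, products included, are symmetric, and transposition reverses a product. *)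
Lemma bose_mesner_mulC F G : F \in BM -> G \in BM -> F *m G = G *m F.
Proof.
move=> hF hG; rewrite -[LHS]bose_mesner_tr ?bose_mesner_mul //.
by rewrite trmx_mul !bose_mesner_tr.
Qed.

Lemma bose_mesner1 : 1%:M \in BM.
Proof.
rewrite -distance_mx0.
by apply: (subvP (sumv_sup (ord0 : 'I_D.+1) _ (subvv _))) => //; apply: memv_line.
Qed.

(** [F *m G] and [F - F *m G] are orthogonal idempotents with sum [F], so minimality of [F] kills
    one of them. *)
Lemma primitive_idempotent_absorb F G :
  primitive_idempotent BM F -> idempotent_in BM G -> F *m G = 0 \/ F *m G = F.
Proof.
move=> [[hF FF] _ Fmin] [hG GG]; have FG := bose_mesner_mulC F G hF hG.
have FGF : F *m (F *m G) = F *m G by rewrite mulmxA FF.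
have FGG : (F *m G) *m G = F *m G by rewrite -mulmxA GG.
have FGF' : (F *m G) *m F = F *m G by rewrite -mulmxA -FG FGF.
have FGFG : (F *m G) *m (F *m G) = F *m G by rewrite mulmxA FGF' FGG.
have [||||/=||] := Fmin (F *m G) (F - F *m G).
- by split=> //; apply: bose_mesner_mul.
- split; first by rewrite memvB ?bose_mesner_mul.
  by rewrite mulmxBl !mulmxBr FF FGF FGF' FGFG subrr subr0.
- by rewrite mulmxBr FGF' FGFG subrr.
- by rewrite mulmxBl FGF FGFG subrr.
- by rewrite addrC subrK.
- by left.
by move/subr0_eq; right.
Qed.

(** Otherwise each absorbs the other, and commutativity gives [F = F *m G = G]. *)
Lemma primitive_idempotent_orth F G :
  primitive_idempotent BM F -> primitive_idempotent BM G ->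
  F != G -> F *m G = 0.
Proof.
move=> hF hG FG; have [[hFM _] _ _] := hF; have [[hGM _] _ _] := hG.
have [//|FGF] := primitive_idempotent_absorb F G hF (let: And3 h _ _ := hG in h).
have [|GFG] := primitive_idempotent_absorb G F hG (let: And3 h _ _ := hF in h).
  by rewrite bose_mesner_mulC.
by case/eqP: FG; rewrite -FGF bose_mesner_mulC.
Qed.

Lemma conj_mxK : involutive (@conj_mx C #|X|).
Proof. by move=> F; apply/matrixP=> i j; rewrite !mxE conjCK. Qed.

Lemma idempotent_conj F : idempotent_in BM F -> idempotent_in BM (conj_mx F).
Proof.
by case=> hF FF; split; [apply: bose_mesner_conj | rewrite -map_mxM FF].
Qed.

(** Conjugation is an involution of the algebra respecting sums and products, so a splitting of
    [conj_mx F] conjugates back to one of [F]. *)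
Lemma primitive_idempotent_conj F :
  primitive_idempotent BM F -> primitive_idempotent BM (conj_mx F).
Proof.
case=> iF F0 Fmin; split; first exact: idempotent_conj.
  by rewrite -(inj_eq (can_inj conj_mxK)) conj_mxK /conj_mx map_mx0.
move=> G H iG iH GH HG /(congr1 (@conj_mx _ _)); rewrite conj_mxK.
rewrite {1}/conj_mx map_mxD => FE.
have z (M : Mat) : map_mx Num.conj M = 0 -> M = 0.
  by move=> M0; rewrite -[M]conj_mxK /conj_mx M0 map_mx0.
have [||||//|/z|/z] := Fmin (conj_mx G) (conj_mx H); try by [left | right].
- exact: idempotent_conj.
- exact: idempotent_conj.
- by rewrite -map_mxM GH map_mx0.
- by rewrite -map_mxM HG map_mx0.
Qed.

(* [F] is symmetric, so [conj_mx F] is its adjoint and [F *m conj_mx F] has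
   diagonal entries [\sum_k `|F i k|^2], not all zero. *)
Lemma primitive_idempotent_real F :
  primitive_idempotent BM F -> conj_mx F = F.
Proof.
move=> hF; have [[hFM _] F0 _] := hF; apply/eqP; apply: contraNT F0 => nF.
(* If [F] and [conj_mx F] differed, their product would vanish. *)
have := primitive_idempotent_orth _ _ hF (primitive_idempotent_conj _ hF).
rewrite eq_sym nF => /(_ isT) /matrixP FF0; apply/eqP/matrixP => i j; rewrite mxE.
move: (FF0 i i); rewrite !mxE => /psumr_eq0P h; apply/eqP.
rewrite -normr_eq0 -sqrf_eq0 normCK.
have sF k : conj_mx F k i = (F i k)^* by rewrite mxE -{1}(bose_mesner_tr F hFM) mxE.
by rewrite -sF h // => k _; rewrite sF mul_conjC_ge0.
Qed.

(* The [D + 1] nonzero orthogonal idempotents form a basis of an algebra of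
   dimension at most [D + 1]. *)
Lemma primitive_idempotents_sum (E : 'I_D.+1 -> Mat) :
  primitive_idempotents e E -> \sum_i E i = 1%:M.
Proof.
case=> Einj EP; have prE i : primitive_idempotent BM (E i) by apply/EP; exists i.
have EE i j : E j *m E i = (i == j)%:R *: E i.
  have [<-|ij] := eqVneq i j; first by have [[_ ->]] := prE i; rewrite scale1r.
  rewrite scale0r primitive_idempotent_orth //.
  by rewrite (inj_eq Einj) eq_sym.
have coefE (c : 'I_D.+1 -> C) j : E j *m (\sum_i c i *: E i) = c j *: E j.
  rewrite mulmx_sumr (bigD1 j) //= big1 => [|i /negPf ij].
    by rewrite addr0 -scalemxAr EE eqxx scale1r.
  by rewrite -scalemxAr EE ij scale0r scaler0.
pose t := [tuple E i | i < D.+1].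
have tE (i : 'I_D.+1) : t`_i = E i by rewrite -tnth_nth tnth_mktuple.
have ft : free t.
  apply/freeP => c c0 j; have := coefE c j.
  rewrite (eq_bigr (fun i => c i *: t`_i)) => [|i _]; last by rewrite tE.
  rewrite c0 mulmx0 => /esym/eqP; rewrite scaler_eq0 => /orP[/eqP //|].
  by have [_ /negPf ->] := prE j.
have st : (<<t>> <= BM)%VS.
  by apply/span_subvP => _ /mapP[i _ ->]; have [[]] := prE i.
have dimBM : (\dim BM <= D.+1)%N.
  apply: leq_trans (leq_of_leqif (dimv_sum_leqif _)) _.
  rewrite -[leqRHS]card_ord -[leqRHS]sum1_card; apply: leq_sum => i _.
  by rewrite /= dim_vline leq_b1.
have tBM : <<t>>%VS = BM.
  by apply/eqP; rewrite eqEdim st (eqP ft) size_tuple.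
have E1 : 1%:M = \sum_i coord t i 1%:M *: E i.
  rewrite [LHS](coord_span (X := t)) ?tBM ?bose_mesner1 //.
  by apply: eq_bigr => i _; rewrite tE.
(* Multiplying the expansion of the identity by [E j] shows that its [j]-th term is [E j]. *)
rewrite [RHS]E1; apply: eq_bigr => j _.
by rewrite -(coefE (coord t ^~ 1%:M)) -E1 mulmx1.
Qed.

End RealIdempotents.

(** * Split subspaces under complex conjugation *)

Section Split.
Variables (C : numClosedFieldType) (X : finType) (e : rel X) (D : nat).
Variables (E : 'I_D.+1 -> 'M[C]_#|X|) (x : X).
Hypothesis e_diam : diameter e = D.
Hypothesis E_real : forall i, conj_mx (E i) = E i.
Hypothesis E_sum : \sum_i E i = 1%:M.
Local Notation Es := (@dual_idempotent C X e D x).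
Local Notation Vec := 'cV[C]_#|X|.
Local Notation V_ := (@Vsplit C X e D E x).
Local Notation acts := (@acts_on_Vtilde C X e D E x).

Lemma dual_idempotent_real i : conj_mx (Es i) = Es i.
Proof. by apply/matrixP=> y z; rewrite !mxE conjC_nat. Qed.

Lemma dual_idempotent_sum : \sum_i Es i = 1%:M.
Proof.
apply/matrixP=> y z; rewrite summxE mxE.
have dD : (gdist e x (enum_val y) < D.+1)%N by rewrite ltnS gdist_le.
rewrite (bigD1 (Ordinal dD)) //= big1 => [|h hd].
  by rewrite mxE eqxx andbT addr0.
have dh : (gdist e x (enum_val y) == h) = false.
  by apply: (contra_neqF _ hd) => /eqP ?; apply: val_inj.
by rewrite mxE dh andbF.
Qed.

Lemma image_spaceP (S : 'M[C]_#|X|) v :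
  reflect (exists u, v = S *m u) (v \in image_space S).
Proof.
apply: (iffP memv_imgP) => [[u _ ->]|[u ->]]; exists u; rewrite ?lfunE //.
exact: memvf.
Qed.

Lemma flag_conj mu (F : 'I_D.+1 -> 'M[C]_#|X|) i (v : Vec) :
    (forall r, conj_mx (F r) = F r) ->
  v \in flag mu F i -> map_mx Num.conj v \in flag mu F i.
Proof.
(* Stated for any real family [G], to serve both [F] and its reversal by [rev_ord]. *)
move=> F_real; have sum_conj (P : pred 'I_D.+1) (G : 'I_D.+1 -> 'M[C]_#|X|) :
    (forall r, conj_mx (G r) = G r) ->
    v \in (\sum_(r | P r) image_space (G r))%VS ->
  map_mx Num.conj v \in (\sum_(r | P r) image_space (G r))%VS.
  move=> G_real /memv_sumP[w wP ->]; apply/memv_sumP.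
  exists (fun r => map_mx Num.conj (w r)); last by rewrite raddf_sum.
  move=> r /wP /image_spaceP[u ->]; apply/image_spaceP.
  by exists (map_mx Num.conj u); rewrite map_mxM -/(conj_mx _) G_real.
by case: mu; apply: sum_conj.
Qed.

Lemma flag_lt0 mu (F : 'I_D.+1 -> 'M[C]_#|X|) : flag mu F (-1) = 0%VS.
Proof. by case: mu; rewrite /flag big_pred0. Qed.

Lemma flagS mu (F : 'I_D.+1 -> 'M[C]_#|X|) i j :
  i <= j -> (flag mu F i <= flag mu F j)%VS.
Proof.
by case: mu => ij; apply/subv_sumP => r ri; apply: sumv_sup (subvv _);
  apply: le_trans ij.
Qed.

Lemma flag_full mu (F : 'I_D.+1 -> 'M[C]_#|X|) :
  \sum_i F i = 1%:M -> flag mu F D = fullv.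
Proof.
move=> F1; apply/vspaceP => v; rewrite memvf -[v]mul1mx.
case: mu; rewrite /flag.
  rewrite -F1 mulmx_suml; apply/memv_sumP; exists (fun r => F r *m v).
    by move=> r _; apply/image_spaceP; exists v.
  by apply: eq_bigl => r; rewrite lez_nat -ltnS ltn_ord.
rewrite -F1 (reindex_inj rev_ord_inj) mulmx_suml; apply/memv_sumP.
exists (fun r => F (rev_ord r) *m v).
  by move=> r _; apply/image_spaceP; exists v.
by apply: eq_bigl => r; rewrite lez_nat -ltnS ltn_ord.
Qed.

Lemma Vsplit_conj mu nu i j (v : Vec) :
  v \in V_ mu nu i j -> map_mx Num.conj v \in V_ mu nu i j.
Proof.
by rewrite !memv_cap => /andP[hi hj]; rewrite !flag_conj //;
  apply: dual_idempotent_real.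
Qed.

Lemma VsplitS mu nu i j i' j' :
  i <= i' -> j <= j' -> (V_ mu nu i j <= V_ mu nu i' j')%VS.
Proof. by move=> ii jj; apply: capvS; apply: flagS. Qed.

(** By [hform_conj] the bar moves to the other argument, which stays in the same sum of split
    subspaces. *)
Lemma in_Vtilde_conj mu nu i j (v : Vec) :
  in_Vtilde e E x mu nu i j v -> in_Vtilde e E x mu nu i j (map_mx Num.conj v).
Proof.
case=> vV vO; split=> [|u /memv_addP[u1 h1 [u2 h2 ->]]]; first exact: Vsplit_conj.
by rewrite hform_conj vO ?rmorph0 // map_mxD memv_add ?Vsplit_conj.
Qed.

(** [conj_mx S] sends [v] to the conjugate of [S] applied to the conjugate of [v], a vector of the
    same space. *)
Lemma acts_on_Vtilde_conj mu nu f S :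
  acts mu nu f S -> acts mu nu (fun i j => (f i j)^*) (conj_mx S).
Proof.
move=> hS i j v /in_Vtilde_conj /hS /(congr1 (map_mx Num.conj)).
rewrite map_mxM map_mxZ /=.
have ->: map_mx Num.conj (map_mx Num.conj v) = v.
  by apply/matrixP=> r s; rewrite !mxE conjCK.
by [].
Qed.

(* The spaces [in_Vtilde] span: each [Vsplit i j] is the sum of [Vtilde i j]
   and of the two smaller spaces it is orthogonal to. *)
Lemma acts_on_Vtilde_unique mu nu f S T :
  acts mu nu f S -> acts mu nu f T -> S = T.
Proof.
move=> hS hT; pose W := lker (linfun (mulmx (S - T)) : 'Hom(Vec, Vec)).
have memW v : (v \in W) = (S *m v == T *m v).
  by rewrite memv_ker lfunE /= mulmxBl subr_eq0.
have Sn n : n.+1%:Z - 1 = n%:Z by rewrite -addn1 PoszD addrK.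
(* Natural indices shifted by one, so that the double induction starts at the zero spaces of index
   -1. *)
have VW a c : (a <= D.+1)%N -> (c <= D.+1)%N -> (V_ mu nu (a%:Z - 1) (c%:Z - 1) <= W)%VS.
  elim: a c => [|a IHa] c aD; first by rewrite sub0r /Vsplit flag_lt0 cap0v sub0v.
  elim: c => [|c IHc] cD; first by rewrite sub0r /Vsplit flag_lt0 capv0 sub0v.
  apply/subvP => v; rewrite !Sn => vV.
  have UW : (V_ mu nu (a%:Z - 1) c + V_ mu nu a (c%:Z - 1) <= W)%VS.
    rewrite subv_add -{1}(Sn c) IHa ?(ltnW aD) //.
    by rewrite -(Sn a) IHc // ltnW.
  have UV : (V_ mu nu (a%:Z - 1) c + V_ mu nu a (c%:Z - 1) <= V_ mu nu a c)%VS.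
    by rewrite subv_add !VsplitS // gerBl.
  (* The projection [w] lies in [W] by induction; the remainder [v - w] lies in a space where [S]
     and [T] act by the same scalar. *)
  have [w wU wO] := orthogonal_projection _ _ (V_ mu nu (a%:Z - 1) c + V_ mu nu a (c%:Z - 1))%VS v.
  rewrite -(subrK w v); apply: memvD; last exact: (subvP UW).
  rewrite memW.
  have vw : in_Vtilde e E x mu nu (Ordinal aD) (Ordinal cD) (v - w).
    by split=> //; rewrite memvB // (subvP UV).
  by rewrite (hS _ _ _ vw) (hT _ _ _ vw).
(* At indices [D], [D] the split subspace is everything, so [S] and [T] agree on the standard
   basis. *)
have colST k : col k S = col k T.
  rewrite !colE; apply/eqP; rewrite -memW.
  apply: (subvP (VW D.+1 D.+1 (leqnn _) (leqnn _))).
  rewrite Sn /Vsplit !flag_full ?capvf ?memvf //.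
  exact: dual_idempotent_sum.
by apply/matrixP => r k; move/colP: (colST k) => /(_ r); rewrite !mxE.
Qed.

Lemma conj_acts_on_Vtilde mu nu f g S T :
    (forall i j, (f i j)^* = g i j) ->
  acts mu nu f S -> acts mu nu g T -> conj_mx S = T.
Proof.
move=> fg /acts_on_Vtilde_conj hS; apply: acts_on_Vtilde_unique.
by move=> i j v /hS ->; rewrite fg.
Qed.

Lemma mxA_conj q : conj_mx (mxA E q) = mxA E q^*.
Proof.
rewrite /conj_mx raddf_sum; apply: eq_bigr => i _ /=.
by rewrite map_mxZ /= -/(conj_mx _) E_real fmorphXz.
Qed.

Lemma mxAs_conj (q : C) : conj_mx (mxAs e D x q) = mxAs e D x q^*.
Proof.
rewrite /conj_mx raddf_sum; apply: eq_bigr => i _ /=.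
by rewrite map_mxZ /= -/(conj_mx _) dual_idempotent_real fmorphXz.
Qed.

End Split.

(** * Conjugates of square roots, and the two cases of the theorem *)

Lemma conj_mx_real (C : numClosedFieldType) n (S : 'M[C]_n) :
  conj_mx S = S -> real_mx S.
Proof. by move=> hS y z; apply/CrealP; rewrite -[in RHS]hS mxE. Qed.

(** As [q ^+ 2] is real, [q^*] is [q] or [- q]; the latter would make [q * q^*] negative. *)
Lemma conj_sqrt_gt0 (C : numClosedFieldType) (q : C) : 0 < q ^+ 2 -> q^* = q.
Proof.
move=> q2; have /eqP : (q^*) ^+ 2 = q ^+ 2.
  by rewrite -rmorphXn /=; apply/CrealP/gtr0_real.
rewrite eqf_sqr => /orP[/eqP //|/eqP qN].
have := mul_conjC_ge0 q; rewrite qN mulrN -expr2 oppr_ge0.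
by move/(lt_le_trans q2); rewrite ltxx.
Qed.

(** Here [q^* = q] is excluded, since [q * q^*] would be the negative [q ^+ 2]. *)
Lemma conj_sqrt_lt0 (C : numClosedFieldType) (q : C) : q ^+ 2 < 0 -> q^* = - q.
Proof.
move=> q2; have /eqP : (q^*) ^+ 2 = q ^+ 2.
  by rewrite -rmorphXn /=; apply/CrealP/ltr0_real.
rewrite eqf_sqr => /orP[/eqP qE|/eqP //].
have := mul_conjC_ge0 q; rewrite qE -expr2.
by move/(lt_le_trans q2); rewrite ltxx.
Qed.

Theorem theorem8p3 (R : realType) (X : finType) (e : rel X) (D : nat)
    (p : nat -> nat -> nat -> nat) (b beta q : R[i])
    (E : 'I_D.+1 -> 'M[R[i]]_#|X|)
    (kr : 'I_D.+1 -> 'I_D.+1 -> 'I_D.+1 -> R[i]) (x : X)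
    (e_sym : symmetric e) (e_irr : irreflexive e)
    (e_conn : forall y z : X, connect e y z)
    (e_diam : diameter e = D) (D_ge3 : (3 <= D)%N)
    (e_dr : has_intersection_numbers e p)
    (b_neq1 : b != 1) (e_cp : classical_parameters_alpha_b1 D p b beta)
    (q_sq : q ^+ 2 = b)
    (E_prim : primitive_idempotents e E)
    (E_krein : krein_parameters E kr)
    (E_selfdual : forall h i j : 'I_D.+1, kr h i j = (p h i j)%:R)
    (B Bs K Ks Phi Psi : 'M[R[i]]_#|X|)
    (hB : is_B e E x q B) (hBs : is_Bs e E x q Bs)
    (hK : is_K e E x q K) (hKs : is_Ks e E x q Ks)
    (hPhi : is_Phi e E x q Phi) (hPsi : is_Psi e E x q Psi) :
  (1 < b ->
    real_mx (mxA E q) /\ real_mx (mxAs e D x q) /\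
    real_mx B /\ real_mx Bs /\ real_mx K /\ real_mx Ks /\
    real_mx Phi /\ real_mx Psi) /\
  (b < -1 ->
    forall B' Bs' K' Ks' Phi' Psi' : 'M[R[i]]_#|X|,
      is_B e E x (- q) B' -> is_Bs e E x (- q) Bs' ->
      is_K e E x (- q) K' -> is_Ks e E x (- q) Ks' ->
      is_Phi e E x (- q) Phi' -> is_Psi e E x (- q) Psi' ->
      conj_mx (mxA E q) = mxA E (- q) /\
      conj_mx (mxAs e D x q) = mxAs e D x (- q) /\
      conj_mx B = B' /\ conj_mx Bs = Bs' /\
      conj_mx K = K' /\ conj_mx Ks = Ks' /\
      conj_mx Phi = Phi' /\ conj_mx Psi = Psi').
Proof.
have E_real i : conj_mx (E i) = E i.
  apply: (@primitive_idempotent_real _ _ e D p) => //.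
  by apply/(proj2 E_prim); exists i.
have E_sum := primitive_idempotents_sum _ _ e D p e_sym e_diam e_dr E E_prim.
have conj_eq mu nu f g S T := @conj_acts_on_Vtilde _ _ e D E x e_diam E_real E_sum mu nu f g S T.
have conj_q (k : int) : (q ^ k)^* = q^* ^ k by rewrite fmorphXz.
split=> [b1|b1].
  have qE : q^* = q by apply: conj_sqrt_gt0; rewrite q_sq (lt_trans ltr01).
  do !split; apply: conj_mx_real.
  - by rewrite mxA_conj // qE.
  - by rewrite mxAs_conj // qE.
  (* From here on each matrix is compared with itself, as conjugation fixes its scalars. *)
  - by apply: (conj_eq _ _ _ _ _ _ _ hB hB) => i j; rewrite conj_q qE.
  - by apply: (conj_eq _ _ _ _ _ _ _ hBs hBs) => i j; rewrite conj_q qE.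
  - by apply: (conj_eq _ _ _ _ _ _ _ hK hK) => i j; rewrite conj_q qE.
  - by apply: (conj_eq _ _ _ _ _ _ _ hKs hKs) => i j; rewrite conj_q qE.
  - by apply: (conj_eq _ _ _ _ _ _ _ hPhi hPhi) => i j; rewrite conj_q qE.
  - by apply: (conj_eq _ _ _ _ _ _ _ hPsi hPsi) => i j; rewrite conj_q qE.
move=> B' Bs' K' Ks' Phi' Psi' hB' hBs' hK' hKs' hPhi' hPsi'.
have qE : q^* = - q.
  by apply: conj_sqrt_lt0; rewrite q_sq (lt_trans b1) // oppr_lt0 ltr01.
do !split.
- by rewrite mxA_conj // qE.
- by rewrite mxAs_conj // qE.
- by apply: conj_eq hB hB' => i j; rewrite conj_q qE.
- by apply: conj_eq hBs hBs' => i j; rewrite conj_q qE.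
- by apply: conj_eq hK hK' => i j; rewrite conj_q qE.
- by apply: conj_eq hKs hKs' => i j; rewrite conj_q qE.
- by apply: conj_eq hPhi hPhi' => i j; rewrite conj_q qE.
- by apply: conj_eq hPsi hPsi' => i j; rewrite conj_q qE.
Qed.
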